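(* Let $F$ be a field of characteristic not two and let $E$ be a finite-dimensional vector space over $F$ with an arbitrary symmetric bilinear form $(U,V)\mapsto U\cdot V$. Suppose the non-null triangle $\overline{UVW}$ in $E$ has quadrances $Q_W=Q(U,V)$, $Q_U=Q(V,W)$, $Q_V=Q(U,W)$, and spreads $s_U=s(UV,UW)$, $s_V=s(VW,VU)$, $s_W=s(WU,WV)$. Then $$(Q_U+Q_V-Q_W)^2=4Q_UQ_V(1-s_W).$$
   Context: Elements of $E$ are called points or vectors. The quadrance between points $U$ and $V$ is $Q(U,V)=(V-U)\cdot(V-U)$. The line $UV$ through distinct points $U,V$ is null if $Q(U,V)=0$, and non-null otherwise. A triangle $\overline{UVW}$ is a set of three distinct non-collinear points; it is non-null when each of the lines $UV$, $VW$, $UW$ is non-null. The spread between non-null lines $UW$ and $VZ$ is $$s(UW,VZ)=1-\frac{\left((W-U)\cdot(Z-V)\right)^2}{Q(U,W)\,Q(V,Z)},$$ which depends only on the two lines. The bilinear form is not assumed non-degenerate. *)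

(* Defs.v *)
From HB Require Import structures.
From mathcomp Require Import all_boot all_order all_algebra.

Set Implicit Arguments.
Unset Strict Implicit.
Unset Printing Implicit Defensive.

Import GRing.Theory.
Local Open Scope ring_scope.

Definition quadrance (F : fieldType) (E : vectType F) (dot : {symmetric E})
    (U V : E) : F :=
  dot (V - U) (V - U).

(* The affine line through U and V; a genuine line only when U != V. *)
Definition line (F : fieldType) (E : vectType F) (U V : E) : pred E :=
  [pred P | P - U \in <[V - U]>%VS].

Definition collinear (F : fieldType) (E : vectType F) (U V W : E) : Prop :=
  exists A B : E,
    [/\ A != B, U \in line A B, V \in line A B & W \in line A B].

Definition triangle (F : fieldType) (E : vectType F) (U V W : E) : Prop :=
  [/\ U != V, V != W, U != W & ~ collinear U V W].

(* A line is presented by two distinct points on it; whether it is null does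
   not depend on the choice of these points. *)
Definition null_line (F : fieldType) (E : vectType F) (dot : {symmetric E})
    (U V : E) : Prop :=
  quadrance dot U V = 0.

Definition nonnull_triangle (F : fieldType) (E : vectType F)
    (dot : {symmetric E}) (U V W : E) : Prop :=
  triangle U V W /\
  [/\ ~ null_line dot U V, ~ null_line dot V W & ~ null_line dot U W].

(* spread dot U W V Z is the spread s(UW, VZ) between the line through U, W
   and the line through V, Z; meaningful only when both lines are non-null. *)
Definition spread (F : fieldType) (E : vectType F) (dot : {symmetric E})
    (U W V Z : E) : F :=
  1 - dot (W - U) (Z - V) ^+ 2 / (quadrance dot U W * quadrance dot V Z).

(* Main.v *)
Require Import Defs.
From HB Require Import structures.
From mathcomp Require Import all_boot all_order all_algebra.
From mathcomp Require Import ring.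

Set Implicit Arguments.
Unset Strict Implicit.
Unset Printing Implicit Defensive.

Import GRing.Theory.
Local Open Scope ring_scope.

(** With [a = U - W] and [b = V - W] the sides at [W], the opposite side is
[V - U = b - a], and expanding its square gives the polarization identity
[Q_U + Q_V - Q_W = 2 (a . b)] ([quadrance_polarization]).  The spread at [W]
is designed so that [1 - s_W] is [(a . b)^2 / (Q_V Q_U)], hence
[Q_V Q_U (1 - s_W) = (a . b)^2] as soon as both sides at [W] are non-null
([cross_spread]).  The theorem is the square of the first identity, with
[(a . b)^2] replaced by means of the second. *)

Lemma symmetric_formC (F : fieldType) (E : vectType F) (dot : {symmetric E})
    (u v : E) : dot u v = dot v u.
Proof. by rewrite hermC /= expr0 mul1r. Qed.

Lemma quadranceC (F : fieldType) (E : vectType F) (dot : {symmetric E})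
    (U V : E) : quadrance dot U V = quadrance dot V U.
Proof. by rewrite /quadrance -opprB linearNl linearNr opprK. Qed.

Lemma quadrance_polarization (F : fieldType) (E : vectType F)
    (dot : {symmetric E}) (U V W : E) :
  quadrance dot W V + quadrance dot W U - quadrance dot U V
    = 2%:R * dot (U - W) (V - W).
Proof.
rewrite /quadrance.
have -> : V - U = (V - W) - (U - W) by rewrite opprB addrA subrK.
move: (U - W) (V - W) => a b.
rewrite linearBl !linearBr /= (symmetric_formC dot b a).
ring.
Qed.

(** The quantity [1 - s], called the cross, plays the part of a squared
cosine.  Without the hypotheses the identity fails: division by zero makes
the left-hand side vanish on null sides, even where [(U - W) . (V - W)] is
nonzero. *)
Lemma cross_spread (F : fieldType) (E : vectType F) (dot : {symmetric E})
    (U V W : E) (nzU : quadrance dot W U != 0) (nzV : quadrance dot W V != 0) :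
  quadrance dot W U * quadrance dot W V * (1 - spread dot W U W V)
    = dot (U - W) (V - W) ^+ 2.
Proof. by rewrite /spread subKr mulrC divfK // mulf_neq0. Qed.

Theorem theorem5 (F : fieldType) (charF : 2%N \notin [pchar F])
    (E : vectType F) (dot : {symmetric E}) (U V W : E)
    (tri : nonnull_triangle dot U V W)
    (Q_U Q_V Q_W s_U s_V s_W : F)
    (defQ_W : Q_W = quadrance dot U V)
    (defQ_U : Q_U = quadrance dot V W)
    (defQ_V : Q_V = quadrance dot U W)
    (defs_U : s_U = spread dot U V U W)
    (defs_V : s_V = spread dot V W V U)
    (defs_W : s_W = spread dot W U W V) :
  (Q_U + Q_V - Q_W) ^+ 2 = 4%:R * Q_U * Q_V * (1 - s_W).
Proof.
case: tri => _ [_ /eqP nzV /eqP nzU].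
rewrite quadranceC in nzV; rewrite quadranceC in nzU.
rewrite defQ_U defQ_V defQ_W defs_W (quadranceC dot V W) (quadranceC dot U W).
rewrite quadrance_polarization exprMn -(cross_spread nzU nzV).
ring.
Qed.
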